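(* Let $n$ and $k$ be nonnegative integers such that $\left\lceil\frac{1+\sqrt{1+4(n-1)}}{2}\right\rceil\leq k\leq\left\lceil\frac{n+1}{2}\right\rceil$. Then there exists a set $\mathcal P$ of $n$ points of $\mathbb R^2$ such that $\gamma^{\mathrm{ID}}_{D}(\mathcal P)=k$.
   Context: A disk of radius $r>0$ and center $c\in\mathbb R^2$ is the set of points of $\mathbb R^2$ at Euclidean distance at most $r$ from $c$. A point is covered by a disk if it belongs to it; two points are separated by a disk if exactly one of them is covered by it. A set $\mathcal D$ of disks identifies a finite set $\mathcal P\subseteq\mathbb R^2$ if every point of $\mathcal P$ is covered by some disk of $\mathcal D$ and every pair of distinct points of $\mathcal P$ is separated by some disk of $\mathcal D$. $\gamma^{\mathrm{ID}}_{D}(\mathcal P)$ denotes the minimum number of disks (of arbitrary radii) in a set identifying $\mathcal P$. *)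

(* Defs.v *)
From HB Require Import structures.
From mathcomp Require Import all_boot all_order all_algebra finmap.
From mathcomp Require Import boolp classical_sets reals.

Set Implicit Arguments.
Unset Strict Implicit.
Unset Printing Implicit Defensive.

Import Order.TTheory GRing.Theory Num.Theory.
Local Open Scope ring_scope.

Definition plane (R : realType) : Type := (R * R)%type.
HB.instance Definition _ (R : realType) := Choice.on (plane R).

(* The library's norm on a product of normed spaces is the sup norm, hence the
   explicit Euclidean distance. *)
Definition edist (R : realType) (x y : plane R) : R :=
  Num.sqrt ((x.1 - y.1) ^+ 2 + (x.2 - y.2) ^+ 2).

Definition closed_disk (R : realType) (c : plane R) (r : R) : set (plane R) :=
  [set x | edist x c <= r]%classic.

Definition is_disk (R : realType) (A : set (plane R)) : Prop :=
  exists (c : plane R) (r : R), 0 < r /\ A = closed_disk c r.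

Definition separated_by (R : realType) (p q : plane R) (A : set (plane R)) :
    Prop :=
  (A p /\ ~ A q) \/ (~ A p /\ A q).

Definition identifies (R : realType) (D : {fset set (plane R)})
    (P : {fset plane R}) : Prop :=
  (forall p, p \in P -> exists2 A, A \in D & A p) /\
  (forall p q, p \in P -> q \in P -> p <> q ->
     exists2 A, A \in D & separated_by p q A).

Definition identifiable_with (R : realType) (P : {fset plane R}) (k : nat) :
    Prop :=
  exists D : {fset set (plane R)},
    [/\ forall A, A \in D -> is_disk A, identifies D P & #|` D| = k].

Lemma edistxx (R : realType) (x : plane R) : edist x x = 0.
Proof. by rewrite /edist !subrr expr0n addr0 sqrtr0. Qed.

Lemma edist_gt0 (R : realType) (x y : plane R) : x <> y -> 0 < edist x y.
Proof.
move=> xy; rewrite /edist sqrtr_gt0 lt_neqAle addr_ge0 ?sqr_ge0 // andbT.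
rewrite eq_sym paddr_eq0 ?sqr_ge0 // !sqrf_eq0 !subr_eq0.
by apply/negP => /andP[/eqP e1 /eqP e2]; apply: xy; case: x y e1 e2 => ? ? [? ?] /= -> ->.
Qed.

Lemma isolating_radius (R : realType) (s : seq (plane R)) (p : plane R) :
  exists r : R, 0 < r /\ forall q, q \in s -> q <> p -> r < edist q p.
Proof.
elim: s => [|a s [r [r0 IH]]]; first by exists 1; split; rewrite ?ltr01.
have [->|/eqP ap] := eqVneq a p.
  by exists r; split=> // q; rewrite inE => /predU1P[->|/IH].
exists (Num.min r (edist a p / 2)); split.
  by rewrite lt_min r0 divr_gt0 ?edist_gt0.
move=> q; rewrite inE gt_min => /predU1P[-> _|qs qp]; last by rewrite IH.
by rewrite ltr_pdivrMr // ltr_pMr ?edist_gt0 ?ltr1n ?orbT.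
Qed.

Lemma exists_identifiable_with (R : realType) (P : {fset plane R}) :
  exists k, `[< identifiable_with P k >].
Proof.
have [r rP] := choice (isolating_radius P).
pose D := [fset closed_disk p (r p) | p in P]%fset.
have DP p : p \in P -> closed_disk p (r p) \in D.
  by move=> pP; apply/imfsetP; exists p.
have cov p : closed_disk p (r p) p.
  by rewrite /closed_disk /= edistxx ltW //; case: (rP p).
exists #|` D|; apply/asboolP; exists D; split=> //.
  by move=> A /imfsetP[p _ ->]; exists p, (r p); split=> //; case: (rP p).
split=> [p pP|p q pP qP pq]; exists (closed_disk p (r p)); rewrite ?DP //.
left; split=> //; rewrite /closed_disk /=; apply/negP; rewrite -ltNge.
by have [_] := rP p; apply => // /esym.
Qed.

(* The minimum exists since the set of cardinalities is nonempty: small enough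
   disks, one centred at each point, identify the points. *)
Definition gammaID (R : realType) (P : {fset plane R}) : nat :=
  ex_minn (exists_identifiable_with P).

(* Main.v *)
Require Import Defs.
From mathcomp Require Import all_boot all_order all_algebra finmap.
From mathcomp Require Import boolp classical_sets reals.
From mathcomp Require Import zify ring lra.

Set Implicit Arguments.
Unset Strict Implicit.
Unset Printing Implicit Defensive.

Import Order.TTheory GRing.Theory Num.Theory.
Local Open Scope ring_scope.

(* A disk meets a line in an interval, so on a line it separates at most two
   pairs of consecutive points; m collinear points leave m - 1 such gaps, plus
   the two outer ones because the extreme points must be covered, hence they
   require at least (m + 1) / 2 disks.

   For the upper bound, take k great circles of the unit sphere in general
   position.  Under stereographic projection they become k disks, and a point
   lies in the i-th one according to the sign of a linear form.  With normals
   (1, i, i^2), the point (d, al, be) gives the sign of the quadratic polynomial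
   d + al t + be t^2 at t = i, so the realised membership patterns are those with
   at most two sign changes, i.e. the cyclic arcs of {0, ..., k - 1}.  There are
   k^2 - k + 1 nonempty ones, and the 2k - 1 coming from polynomials of degree
   at most 1 are realised on the x-axis.  Taking n of these points, starting
   with those on the axis, gives the set sought. *)

(** * Lower bound for collinear points *)

Lemma closed_disk_xaxis_convex (R : realType) (c : plane R) (r x y z : R) :
  0 < r -> x < y -> y < z ->
  closed_disk c r (x, 0) -> closed_disk c r (z, 0) -> closed_disk c r (y, 0).
Proof.
move=> r0 xy yz; rewrite /closed_disk /edist /=.
have rE : r = Num.sqrt (r ^+ 2) by rewrite sqrtr_sqr gtr0_norm.
rewrite rE !ler_sqrt ?sqr_ge0 // => hx hz.
(* If [y <= c.1], then [x] is farther from [c] than [y]; otherwise [z] is. *)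
by case: (leP y c.1) => yc; nra.
Qed.

Lemma collinear_lower_bound (R : realType) (P : {fset plane R})
    (D : {fset set (plane R)}) (s : seq R) :
  (forall A, A \in D -> is_disk A) -> identifies D P ->
  sorted <%R s -> (0 < size s)%N -> (forall x, x \in s -> (x, 0) \in P) ->
  ((size s).+1 <= 2 * #|` D|)%N.
Proof.
move=> diskD [covD sepD] s_sorted s_gt0 sP.
set m := size s.
pose pt i : plane R := (nth 0 s i, 0).
have ptP i : (i < m)%N -> pt i \in P by move=> im; apply/sP/mem_nth.
have pt_lt i j : (i < j)%N -> (j < m)%N -> nth 0 s i < nth 0 s j.
  by move=> ij jm; rewrite lt_sorted_ltn_nth // inE; apply: ltn_trans jm.
(* Points occupy positions 1 to [m]; positions 0 and [m.+1] count as outside every disk, so covering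
   an extreme point crosses an outer gap. *)
pose B (A : set (plane R)) j := (0 < j <= m)%N && `[< A (pt j.-1) >].
have B_convex A i l j : A \in D -> (i < l)%N -> (l < j)%N ->
    B A i -> B A j -> B A l.
  move=> /diskD[c [r [r0 ->]]] il lj.
  case/andP=> /andP[i0 im] /asboolP Ai /andP[/andP[j0 jm]] /asboolP Aj.
  apply/andP; split; first lia.
  by apply/asboolP; apply: closed_disk_xaxis_convex Ai Aj => //; apply: pt_lt; lia.
(* Each gap is charged to a disk together with the direction of the crossing,
   and convexity makes this injective. *)
have cross (g : 'I_m.+1) : exists x : D * bool,
    B (val x.1) g = x.2 /\ B (val x.1) g.+1 = ~~ x.2.
  case: g => -[|g] /= gm.
    have [A AD Ap] := covD _ (ptP 0 s_gt0).
    exists ([` AD]%fset, false) => /=; rewrite /B /= s_gt0; split=> //.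
    exact/asboolP.
  have [->|g_neq] := eqVneq g.+1 m.
    have [A AD Ap] := covD _ (ptP m.-1 ltac:(lia)).
    exists ([` AD]%fset, true) => /=; rewrite /B ltnn leqnn s_gt0 /=.
    by split=> //; apply/asboolP.
  have neq_pt : pt g <> pt g.+1.
    by case=> /eqP; rewrite lt_eqF //; apply: pt_lt; lia.
  have [A AD sepA] := sepD _ _ (ptP g ltac:(lia)) (ptP g.+1 ltac:(lia)) neq_pt.
  have [gm0 gm1] : (g < m)%N /\ (g.+1 < m)%N by lia.
  case: sepA => -[A1 A2].
    by exists ([` AD]%fset, true); rewrite /B /= gm0 gm1 /= asboolT ?asboolF.
  by exists ([` AD]%fset, false); rewrite /B /= gm0 gm1 /= asboolF ?asboolT.
have [f fP] := choice cross.
have f_lt (g h : 'I_m.+1) : (g < h)%N -> f g <> f h.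
  move=> gh fgh; have [] := fP g; have [] := fP h; rewrite -fgh.
  (* Two exits put [g] and [h] inside but [g.+1] outside; two entries put [g.+1] and [h.+1] inside
     but [h] outside. *)
  case: (f g) => A [] /= Bh Bh1 Bg Bg1.
    have [gh1|gh1] := eqVneq g.+1 h; first by rewrite gh1 Bh in Bg1.
    have := B_convex (val A) g g.+1 h (valP A) (ltnSn _).
    by rewrite Bg1 Bg Bh; move=> /(_ ltac:(lia) isT isT).
  have [gh1|gh1] := eqVneq g.+1 h; first by rewrite gh1 Bh in Bg1.
  have := B_convex (val A) g.+1 h h.+1 (valP A).
  by rewrite Bg1 Bh Bh1; move=> /(_ ltac:(lia) (ltnSn _) isT isT).
have f_inj : injective f.
  move=> g h fgh; apply/val_inj; have [gh|hg|//] := ltngtP g h.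
    by case: (f_lt _ _ gh).
  by case: (f_lt _ _ hg).
by have := leq_card f f_inj; rewrite card_ord card_prod card_bool -cardfE mulnC.
Qed.

(** * Great circles under stereographic projection *)

(* Projection from (0, 0, -1) of the normalisation of (al, be, d). *)
Definition stereo (R : realType) (al be d : R) : plane R :=
  let e := d + Num.sqrt (al ^+ 2 + be ^+ 2 + d ^+ 2) in (al / e, be / e).

(* The circles having power -1 at the origin are the stereographic images of the
   great circles (other than those through the pole). *)
Definition great_disk (R : realType) (c : plane R) : set (plane R) :=
  closed_disk c (Num.sqrt (1 + c.1 ^+ 2 + c.2 ^+ 2)).

Lemma great_disk_is_disk (R : realType) (c : plane R) : is_disk (great_disk c).
Proof.
exists c, (Num.sqrt (1 + c.1 ^+ 2 + c.2 ^+ 2)); split=> //.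
by rewrite sqrtr_gt0 -addrA ltr_pwDl // addr_ge0 ?sqr_ge0.
Qed.

(** Since [al ^+ 2 + be ^+ 2 = rho ^+ 2 - d ^+ 2], the squared radius minus the squared distance to
    [c] is the linear form times the positive factor [2 / (d + rho)]. *)
Lemma stereo_great_disk (R : realType) (al be d : R) (c : plane R) :
  0 < d + Num.sqrt (al ^+ 2 + be ^+ 2 + d ^+ 2) ->
  great_disk c (stereo al be d) <-> 0 <= d + al * c.1 + be * c.2.
Proof.
rewrite /great_disk /closed_disk /stereo /edist /=.
set rho := Num.sqrt (_ + d ^+ 2) => e0.
have rho2 : rho ^+ 2 = al ^+ 2 + be ^+ 2 + d ^+ 2.
  by rewrite sqr_sqrtr // !addr_ge0 ?sqr_ge0.
rewrite ler_sqrt; last by rewrite !addr_ge0 ?sqr_ge0.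
rewrite -(subr_ge0 (_ ^+ 2 + _ ^+ 2)).
have -> : 1 + c.1 ^+ 2 + c.2 ^+ 2 - ((al / (d + rho) - c.1) ^+ 2 +
    (be / (d + rho) - c.2) ^+ 2) = 2 / (d + rho) * (d + al * c.1 + be * c.2).
  have -> : 1 + c.1 ^+ 2 + c.2 ^+ 2 - ((al / (d + rho) - c.1) ^+ 2 +
    (be / (d + rho) - c.2) ^+ 2) = 1 - (al ^+ 2 + be ^+ 2) / (d + rho) ^+ 2 +
      2 / (d + rho) * (al * c.1 + be * c.2) by field; rewrite gt_eqF.
  have -> : al ^+ 2 + be ^+ 2 = rho ^+ 2 - d ^+ 2 by rewrite rho2; ring.
  by field; rewrite gt_eqF.
by rewrite pmulr_rge0 ?divr_gt0.
Qed.

(** The condition excludes exactly the zero vector and the ray through the centre of projection,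
    where the denominator vanishes. *)
Lemma stereo_denom_gt0 (R : realType) (al be d : R) :
  [|| al != 0, be != 0 | 0 < d] -> 0 < d + Num.sqrt (al ^+ 2 + be ^+ 2 + d ^+ 2).
Proof.
rewrite orbA => /orP[h|h]; last by rewrite ltr_pwDl ?sqrtr_ge0.
have ab : 0 < al ^+ 2 + be ^+ 2.
  by rewrite lt0r addr_ge0 ?sqr_ge0 // andbT paddr_eq0 ?sqr_ge0 // !sqrf_eq0 negb_and.
rewrite -ltrBlDl sub0r; apply: le_lt_trans (ler_norm _) _.
by rewrite normrN -sqrtr_sqr ltr_sqrt ?ltrDr // ltr_pwDl ?sqr_ge0.
Qed.

(** * Cyclic arcs and their membership patterns *)

(* A pair (a, b) with a != b encodes the cyclic arc from a to b - 1, and (0, 0)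
   the whole cycle. *)
Definition in_arc (p : nat * nat) (i : nat) : bool :=
  ((p.1 <= i)%N == (p.2 <= i)%N) == (p.2 <= p.1)%N.

Definition arc (k : nat) (p : nat * nat) : bool :=
  [&& (p.1 < k)%N, (p.2 < k)%N & (p.1 != p.2) || (p == (0, 0)%N)].

Lemma in_arc_start (p : nat * nat) : in_arc p p.1.
Proof. by rewrite /in_arc leqnn eq_sym; case: leqP. Qed.

Definition cpred (k i : nat) : nat := if i is j.+1 then j else k.-1.

(** Recovers the start of a proper arc from its membership pattern. *)
Lemma in_arc_entry (k : nat) (p : nat * nat) (i : nat) :
  (p.1 < k)%N -> (p.2 < k)%N -> p.1 != p.2 ->
  in_arc p i && ~~ in_arc p (cpred k i) = (i == p.1).
Proof.
case: p => a b /= ak bk ab; rewrite /in_arc /=.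
case: i => [|i] /=; last first.
  case: (leqP b a) => ?; case: (leqP a i) => ?; case: (leqP b i) => ?;
    case: (leqP a i.+1) => ?; case: (leqP b i.+1) => ? /=; lia.
have -> : (a <= k.-1)%N by lia.
have -> : (b <= k.-1)%N by lia.
by case: a b ak bk ab => [|a] [|b] //= _ _ ab;
  rewrite ?ltn0 ?leqn0 ?eqxx //=; case: (_ <= _)%N.
Qed.

Lemma in_arc_swap (p : nat * nat) (i : nat) :
  p.1 != p.2 -> in_arc (p.2, p.1) i = ~~ in_arc p i.
Proof.
rewrite /in_arc /= neq_ltn.
by case: (ltngtP p.1 p.2) => //= _ _; case: (p.1 <= i)%N; case: (p.2 <= i)%N.
Qed.

(** Leaving an arc is entering its complement, which has the endpoints exchanged. *)
Lemma in_arc_exit (k : nat) (p : nat * nat) (i : nat) :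
  (p.1 < k)%N -> (p.2 < k)%N -> p.1 != p.2 ->
  ~~ in_arc p i && in_arc p (cpred k i) = (i == p.2).
Proof.
move=> p1k p2k pN; rewrite -(@in_arc_entry k (p.2, p.1)) 1?eq_sym //.
by rewrite !in_arc_swap // negbK.
Qed.

(** Entry and exit determine a proper arc; the whole cycle has no entry, which tells it apart from
    proper arcs. *)
Lemma in_arc_inj (k : nat) (p q : nat * nat) : arc k p -> arc k q ->
  (forall i, (i < k)%N -> in_arc p i = in_arc q i) -> p = q.
Proof.
move=> /and3P[p1k p2k pP] /and3P[q1k q2k qP] pq.
have cpred_lt i : (i < k)%N -> (cpred k i < k)%N by case: i => [|i] /=; lia.
have entry i : (i < k)%N -> in_arc p i && ~~ in_arc p (cpred k i) =
    in_arc q i && ~~ in_arc q (cpred k i) by move=> ik; rewrite !pq ?cpred_lt.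
have exit i : (i < k)%N -> ~~ in_arc p i && in_arc p (cpred k i) =
    ~~ in_arc q i && in_arc q (cpred k i) by move=> ik; rewrite !pq ?cpred_lt.
have [pN|] := boolP (p.1 != p.2); have [qN|] := boolP (q.1 != q.2).
- have := entry _ p1k; have := exit _ p2k.
  rewrite !in_arc_entry // !in_arc_exit // !eqxx => /esym/eqP e2 /esym/eqP e1.
  by rewrite [p]surjective_pairing e1 e2 -surjective_pairing.
- move=> qN; have := entry _ p1k; rewrite in_arc_entry // eqxx.
  by move: qP; rewrite (negbTE qN) => /eqP ->; rewrite /in_arc !leq0n.
- move=> pN; have := entry _ q1k; rewrite (in_arc_entry _ q1k) // eqxx.
  by move: pP; rewrite (negbTE pN) => /eqP ->; rewrite /in_arc !leq0n.
- move=> qN pN; move: pP qP.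
  by rewrite (negbTE pN) (negbTE qN) => /eqP -> /eqP ->.
Qed.

(** * Points realising the arcs *)

(* Coefficients of t - a + 1/2, whose sign at t = i tells whether a <= i.  At
   a = 0 the constant 1 has the same signs and lowers the degree, which puts the
   arcs with an endpoint 0 on the x-axis. *)
Definition lin_coef (R : realType) (a : nat) : R * R :=
  if a is 0%N then (1, 0) else (1 / 2 - a%:R, 1).

Definition lin (R : realType) (a : nat) (t : R) : R :=
  (lin_coef R a).1 + (lin_coef R a).2 * t.

Lemma lin_gt0 (R : realType) (a i : nat) :
  (a <= i)%N -> 0 < lin a i%:R :> R.
Proof.
rewrite /lin; case: a => [|a] /= ai; first by rewrite mul0r addr0.
by have : a.+1%:R <= i%:R :> R; [rewrite ler_nat|lra].
Qed.

Lemma lin_lt0 (R : realType) (a i : nat) :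
  (i < a)%N -> lin a i%:R < 0 :> R.
Proof.
rewrite /lin; case: a => [|a] //= ia.
have : i.+1%:R <= a.+1%:R :> R by rewrite ler_nat.
by rewrite -natr1; lra.
Qed.

(** The arguments of [stereo] are the coefficients of degrees 1, 2 and 0 of the product of the two
    linear polynomials, up to the sign [s]. *)
Definition arc_point (R : realType) (p : nat * nat) : plane R :=
  let f := lin_coef R p.1 in let g := lin_coef R p.2 in
  let s := (-1) ^+ (p.1 < p.2)%N in
  stereo (s * (f.1 * g.2 + f.2 * g.1)) (s * (f.2 * g.2)) (s * (f.1 * g.1)).

Definition moment_disk (R : realType) (i : nat) : set (plane R) :=
  great_disk (i%:R, i%:R ^+ 2).
Arguments moment_disk : clear implicits.

Lemma moment_diskP (R : realType) (k : nat) (p : nat * nat) (i : nat) :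
  arc k p -> moment_disk R i (arc_point R p) <-> in_arc p i.
Proof.
move=> /and3P[_ _ pP]; rewrite /moment_disk /arc_point stereo_great_disk /=.
  set s := (-1) ^+ _.
  have -> : s * ((lin_coef R p.1).1 * (lin_coef R p.2).1) +
      s * ((lin_coef R p.1).1 * (lin_coef R p.2).2 +
           (lin_coef R p.1).2 * (lin_coef R p.2).1) * i%:R +
      s * ((lin_coef R p.1).2 * (lin_coef R p.2).2) * i%:R ^+ 2 =
    s * (lin p.1 i%:R * lin p.2 i%:R) by rewrite /lin; ring.
  (* The product is positive when both factors have the same sign; [s] reverses this when
     [p.1 < p.2], matching [in_arc]. *)
  rewrite /in_arc {}/s; case: (leqP p.2 p.1) => _ /=;
    rewrite ?expr0 ?expr1 ?mul1r ?mulN1r ?oppr_ge0;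
    case: (leqP p.1 i) => [/(@lin_gt0 R)|/(@lin_lt0 R)] h1;
    case: (leqP p.2 i) => [/(@lin_gt0 R)|/(@lin_lt0 R)] h2 /=;
    split=> //; nra.
(* The leading coefficient is [s]: [be] if both endpoints are positive, [al] if exactly one is;
   [(0, 0)] gives [d = 1]. *)
apply: stereo_denom_gt0; case: p pP => -[|a] [|b] /= pP;
  by rewrite ?(mulr0, mul0r, mulr1, mul1r, addr0, add0r) ?signr_eq0 ?oner_eq0
    ?expr0 ?ltr01 ?orbT.
Qed.

Lemma arc_point_inj (R : realType) (k : nat) :
  {in arc k &, injective (arc_point R)}.
Proof.
move=> p q pk qk pq; apply: (in_arc_inj pk qk) => i _.
by apply/idP/idP => /(moment_diskP R) h; apply/(moment_diskP R);
  [exact: qk|rewrite -pq; apply/h/pk|exact: pk|rewrite pq; apply/h/qk].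
Qed.

(** * Enumeration of the arcs *)

Definition axis_arcs (k : nat) : seq (nat * nat) :=
  (0, 0)%N :: [seq (0, b.+1)%N | b <- iota 0 k] ++
              [seq (a.+1, 0)%N | a <- iota 0 k].

(** [bump a] skips the value [a], so the two endpoints are distinct. *)
Definition off_axis_arcs (k : nat) : seq (nat * nat) :=
  [seq (a.+1, (bump a b).+1) | a <- iota 0 k, b <- iota 0 k.-1].

Lemma size_axis_arcs (k : nat) : size (axis_arcs k) = (2 * k).+1.
Proof. by rewrite /= size_cat !size_map size_iota; lia. Qed.

Lemma size_arcs (k : nat) :
  size (axis_arcs k ++ off_axis_arcs k) = (k ^ 2 + k).+1.
Proof.
by rewrite size_cat size_axis_arcs size_allpairs !size_iota; case: k => //=; nia.
Qed.

Lemma uniq_arcs (k : nat) : uniq (axis_arcs k ++ off_axis_arcs k).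
Proof.
have inj0 : injective (fun b => (0, b.+1)%N) by move=> ? ? [].
have inj1 : injective (fun a => (a.+1, 0)%N) by move=> ? ? [].
rewrite cat_uniq /= cat_uniq !map_inj_uniq ?iota_uniq // andbT /=.
rewrite -!andbA; apply/and4P; split.
- by rewrite mem_cat negb_or; apply/andP; split; apply/negP => /mapP[].
- by apply/hasPn => p /mapP[a _ ->]; apply/negP => /mapP[].
- apply/hasPn => p /allpairsP[[a b] /= [_ _ ->]]; rewrite inE mem_cat /= !negb_or.
  by apply/andP; split; apply/negP => /mapP[].
apply: allpairs_uniq; rewrite ?iota_uniq // => -[a b] [c d] _ _ /= [-> ].
by move/(can_inj (bumpK c)) => ->.
Qed.

Lemma arc_arcs (k : nat) (p : nat * nat) :
  p \in axis_arcs k ++ off_axis_arcs k -> arc k.+1 p.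
Proof.
rewrite mem_cat inE mem_cat -!orbA => /or4P[/eqP -> //|||].
- by move=> /mapP[b]; rewrite mem_iota /arc => bk -> /=; rewrite ltnS; lia.
- by move=> /mapP[b]; rewrite mem_iota /arc => bk -> /=; rewrite ltnS; lia.
move=> /allpairsP[[a b] /= []]; rewrite !mem_iota /arc => ak bk -> /=.
by rewrite eqSS neq_bump /= !ltnS; rewrite /bump; lia.
Qed.

(** An endpoint 0 contributes a constant factor, which kills the quadratic coefficient. *)
Lemma arc_point_axis (R : realType) (k : nat) (p : nat * nat) :
  p \in axis_arcs k -> (arc_point R p).2 = 0.
Proof.
by rewrite inE mem_cat => /or3P[/eqP->|/mapP[b _ ->]|/mapP[a _ ->]];
  rewrite /arc_point /stereo /= ?mul0r ?mulr0 ?mul0r.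
Qed.

(** * Choice of the [n] points and comparison of both bounds *)

Theorem theorem9 (R : realType) (n k : nat)
    (hn : (0 : R) <= 1 + 4 * (n%:R - 1))
    (hlow : Num.ceil ((1 + Num.sqrt (1 + 4 * (n%:R - 1))) / 2 : R) <= k%:Z)
    (hup : k%:Z <= Num.ceil ((n%:R + 1) / 2 : R)) :
  exists P : {fset plane R}, #|` P| = n /\ gammaID P = k.
Proof.
have n_gt0 : (0 < n)%N.
  by case: n hn {hlow hup} => //; rewrite sub0r; lra.
have k_sqrt : Num.sqrt (1 + 4 * (n%:R - 1)) <= 2 * k%:R - 1 :> R.
  by move: hlow; rewrite ceil_le_int -pmulrn; lra.
have k_gt0 : (0 < k)%N.
  case: k k_sqrt {hlow hup} => // /(le_trans (sqrtr_ge0 _)).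
  by rewrite mulr0 sub0r oppr_ge0 ler10.
(* Squaring [k_sqrt] bounds [n] by the number [k ^ 2 - k + 1] of arcs. *)
have n_ub : (n + k <= k ^ 2 + 1)%N.
  rewrite -(ler_nat R) !natrD natrX.
  have := sqr_sqrtr hn; have := sqrtr_ge0 (1 + 4 * (n%:R - 1) : R).
  by nra.
have n_lb : (2 * k <= n + 2)%N.
  have : k%:Z - 1 < Num.ceil ((n%:R + 1) / 2 : R) by rewrite ltrBlDr ltzD1.
  rewrite ceil_gt_int intrB -pmulrn => h.
  suff : (2 * k < n + 3)%N by lia.
  by rewrite -(ltr_nat R) natrM natrD; lra.
(* The lists of arcs are indexed by the number of disks minus one. *)
case: k k_gt0 n_ub n_lb {hlow hup k_sqrt} => // k _ n_ub n_lb.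
set arcs := axis_arcs k ++ off_axis_arcs k.
pose s := take n arcs.
have s_arc p : p \in s -> arc k.+1 p by move=> /mem_take/arc_arcs.
have s_uniq : uniq s by rewrite take_uniq // uniq_arcs.
pose P : {fset plane R} := [fset x in map (arc_point R) s]%fset.
have memP x : (x \in P) = (x \in map (arc_point R) s) by rewrite inE.
exists P; split.
  rewrite card_fseq undup_id.
    by rewrite size_map size_takel // size_arcs; lia.
  rewrite map_inj_in_uniq // => p q ps qs; apply: (@arc_point_inj R k.+1).
    exact: s_arc.
  exact: s_arc.
rewrite /gammaID; case: ex_minnP => m /asboolP[D [diskD identD <-]] m_min.
apply/eqP; rewrite eqn_leq; apply/andP; split; last first.
  pose t := take n (axis_arcs k).
  have ts p : p \in t -> p \in s.
    rewrite /s /arcs take_cat; case: ltnP => // hs; rewrite mem_cat.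
    by move/mem_take => ->.
  have t_axis p : p \in t -> arc_point R p = ((arc_point R p).1, 0).
    by move=> /mem_take/arc_point_axis <-; rewrite -surjective_pairing.
  pose xs := sort <=%R [seq (arc_point R p).1 | p <- t].
  have size_xs : size xs = minn n (2 * k).+1.
    by rewrite size_sort size_map size_take_min size_axis_arcs.
  have := @collinear_lower_bound R P D xs diskD identD.
  rewrite size_xs sort_lt_sorted map_inj_in_uniq; last first.
    move=> p q pt qt pq; apply: (@arc_point_inj R k.+1).
    - exact/s_arc/ts.
    - exact/s_arc/ts.
    by rewrite t_axis // (t_axis q) // pq.
  rewrite take_uniq; last by have := uniq_arcs k; rewrite cat_uniq => /and3P[].
  suff h : forall x, x \in xs -> (x, 0) \in P by move=> /(_ isT ltac:(lia) h); lia.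
  move=> x; rewrite mem_sort => /mapP[p pt ->]; rewrite memP -t_axis //.
  exact/map_f/ts.
(* For the upper bound, the moment disk at the start of an arc covers its point, and [in_arc_inj]
   provides separating disks. *)
pose E : {fset set (plane R)} :=
  [fset A in map (moment_disk R) (iota 0 k.+1)]%fset.
have ED i : (i < k.+1)%N -> moment_disk R i \in E.
  by move=> ik; rewrite in_fset; apply/map_f; rewrite mem_iota.
have cardE : (#|` E| <= k.+1)%N.
  by rewrite card_fseq (leq_trans (size_undup _)) // size_map size_iota.
apply: leq_trans cardE; apply: m_min; apply/asboolP; exists E; split=> //.
  by move=> A; rewrite in_fset => /mapP[i _ ->]; apply: great_disk_is_disk.
split=> [x|x y]; rewrite !memP.
  move=> /mapP[p ps ->]; exists (moment_disk R p.1).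
    by apply: ED; have /and3P[] := s_arc _ ps.
  by apply/(moment_diskP _ _ (s_arc _ ps)); apply: in_arc_start.
move=> /mapP[p ps ->] /mapP[q qs ->] pq.
have [i ik ipq] : exists2 i, (i < k.+1)%N & in_arc p i != in_arc q i.
  apply: contrapT => h; apply: pq; congr arc_point.
  apply: (in_arc_inj (s_arc _ ps) (s_arc _ qs)) => i ik.
  by apply: contrapT => /eqP ipq; apply: h; exists i.
exists (moment_disk R i); first exact: ED.
rewrite /separated_by !(propext (moment_diskP _ _ (s_arc _ ps)))
  !(propext (moment_diskP _ _ (s_arc _ qs))).
by case: (in_arc p i) (in_arc q i) ipq => [] [] // _; [left|right].
Qed.
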